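(* Let $H$ be an arbitrary finite simple graph and let $F = P_3 \sqcup K_1 \sqcup H$. Then $D[F] \leq v(F) - 1$.
   Context: All graphs are finite simple graphs. Consider first-order logic over graphs whose signature consists of two binary predicate symbols: $\sim$ (adjacency) and $=$ (equality). For a graph $F$, let $\mathcal{C}[F]$ be the property (class of graphs) of containing an induced subgraph isomorphic to $F$. A sentence $\varphi$ expresses $\mathcal{C}[F]$ if for every graph $G$: $G \models \varphi \iff G \in \mathcal{C}[F]$. $D[F]$ denotes the minimal quantifier depth (maximal length of a chain of nested quantifiers) of a first-order sentence expressing $\mathcal{C}[F]$. $v(F)$ is the number of vertices of $F$. $P_3$ is the path on $3$ vertices, $K_1$ is the one-vertex graph, and $A \sqcup B$ denotes the disjoint union of graphs $A$ and $B$. *)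

(* Defs.v *)
From HB Require Import structures.
From mathcomp Require Import all_boot.
From mathcomp Require Import boolp.

Set Implicit Arguments.
Unset Strict Implicit.
Unset Printing Implicit Defensive.

(* Finite simple graphs; the graph without vertices is allowed. *)
Record sgraph := SGraph {
  vertex :> finType;
  adj : rel vertex;
  adj_sym : symmetric adj;
  adj_irr : irreflexive adj }.
Arguments adj {s}.

Definition num_vertices (G : sgraph) : nat := #|vertex G|.

Definition isomorphic (G H : sgraph) : Prop :=
  exists f : G -> H, bijective f /\ forall x y, adj (f x) (f y) = adj x y.

Section Induced.
Variables (G : sgraph) (S : {set G}).
Definition induced_rel : rel {x : G | x \in S} := fun x y => adj (val x) (val y).
Lemma induced_sym : symmetric induced_rel.
Proof. by move=> x y; apply: adj_sym. Qed.
Lemma induced_irr : irreflexive induced_rel.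
Proof. by move=> x; apply: adj_irr. Qed.
Definition induced : sgraph := SGraph induced_sym induced_irr.
End Induced.

(* G belongs to C[F]. *)
Definition contains_induced (F G : sgraph) : Prop :=
  exists S : {set G}, isomorphic (induced S) F.

Section PathGraph.
Variable n : nat.
Definition path_rel : rel 'I_n :=
  fun i j => (i.+1 == j :> nat) || (j.+1 == i :> nat).
Lemma path_sym : symmetric path_rel.
Proof. by move=> i j; rewrite /path_rel orbC. Qed.
Lemma path_irr : irreflexive path_rel.
Proof. by move=> i; rewrite /path_rel orbb gtn_eqF. Qed.
(* The path on n vertices. *)
Definition path_graph : sgraph := SGraph path_sym path_irr.
End PathGraph.

Section CompleteGraph.
Variable n : nat.
Definition complete_rel : rel 'I_n := fun i j => i != j.
Lemma complete_sym : symmetric complete_rel.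
Proof. by move=> i j; rewrite /complete_rel eq_sym. Qed.
Lemma complete_irr : irreflexive complete_rel.
Proof. by move=> i; rewrite /complete_rel eqxx. Qed.
Definition complete_graph : sgraph := SGraph complete_sym complete_irr.
End CompleteGraph.

Section DisjointUnion.
Variables G H : sgraph.
Definition dunion_rel : rel (G + H)%type := fun x y =>
  match x, y with
  | inl a, inl b => adj a b
  | inr a, inr b => adj a b
  | _, _ => false
  end.
Lemma dunion_sym : symmetric dunion_rel.
Proof. by move=> [x|x] [y|y] //=; apply: adj_sym. Qed.
Lemma dunion_irr : irreflexive dunion_rel.
Proof. by move=> [x|x]; apply: adj_irr. Qed.
Definition dunion : sgraph := SGraph dunion_sym dunion_irr.
End DisjointUnion.

(* First-order formulas over {~, =} with free variables among 'I_n, in        *)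
(* de Bruijn style: a quantifier binds variable ord0 of its body and shifts   *)
(* the others by lift ord0.                                                   *)
Inductive formula : nat -> Type :=
| FAdj n (i j : 'I_n) : formula n
| FEq n (i j : 'I_n) : formula n
| FNot n (p : formula n) : formula n
| FAnd n (p q : formula n) : formula n
| FOr n (p q : formula n) : formula n
| FEx n (p : formula n.+1) : formula n
| FAll n (p : formula n.+1) : formula n.

Definition sentence := formula 0.

Fixpoint qdepth n (p : formula n) : nat :=
  match p with
  | FAdj _ _ _ | FEq _ _ _ => 0
  | FNot _ p => qdepth p
  | FAnd _ p q | FOr _ p q => maxn (qdepth p) (qdepth q)
  | FEx _ p | FAll _ p => (qdepth p).+1
  end.

Definition env_cons (T : Type) n (x : T) (e : 'I_n -> T) : 'I_n.+1 -> T :=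
  fun i => if unlift ord0 i is Some j then e j else x.

Definition env_nil (T : Type) : 'I_0 -> T :=
  fun i => False_rect T (notF (ltn_ord i)).

Fixpoint sat (G : sgraph) n (p : formula n) : ('I_n -> G) -> Prop :=
  match p with
  | FAdj _ i j => fun e => adj (e i) (e j)
  | FEq _ i j => fun e => e i = e j
  | FNot _ p => fun e => ~ sat p e
  | FAnd _ p q => fun e => sat p e /\ sat q e
  | FOr _ p q => fun e => sat p e \/ sat q e
  | FEx _ p => fun e => exists x : G, sat p (env_cons x e)
  | FAll _ p => fun e => forall x : G, sat p (env_cons x e)
  end.

Definition models (G : sgraph) (p : sentence) : Prop := sat p (@env_nil G).

Definition expresses (p : sentence) (C : sgraph -> Prop) : Prop :=
  forall G : sgraph, models G p <-> C G.

(* The rest shows that C[F] is expressible, so that the minimum D[F] exists:  *)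
(* the sentence asserts that there are #|F| distinct vertices whose           *)
(* adjacencies are those of F.                                                *)
Lemma contains_inducedP (F G : sgraph) :
  contains_induced F G <->
  exists f : F -> G, injective f /\ forall x y, adj (f x) (f y) = adj x y.
Proof.
split=> [[S [f [[g fK gK] fadj]]]|[f [finj fadj]]].
  exists (fun x => val (g x)); split=> [x y /val_inj /(can_inj gK)//|x y].
  by rewrite -[in RHS](gK x) -[in RHS](gK y) fadj.
have im x : f x \in f @: [set: F] by apply: imset_f; rewrite inE.
pose g (x : F) : induced (f @: [set: F]) := exist _ (f x) (im x).
have ginj : injective g by move=> x y [/finj].
have gsur y : exists x, g x = y.
  by case: y => y yS; have /imsetP[x _ yE] := yS; exists x; apply: val_inj.
exists (f @: [set: F]); have [h hP] := choice gsur.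
exists h; split; first by exists g => // x; apply: ginj.
by move=> x y; rewrite -fadj -[in RHS](hP x) -[in RHS](hP y).
Qed.

Fixpoint ex_closure n : formula n -> sentence :=
  match n with
  | 0 => id
  | m.+1 => fun p => ex_closure (FEx p)
  end.

Lemma models_ex_closure (G : sgraph) n (p : formula n) :
  models G (ex_closure p) <-> exists e : 'I_n -> G, sat p e.
Proof.
elim: n p => [|n IH] p /=.
  split=> [pG|[e pe]]; first by exists (@env_nil G).
  by rewrite /models (_ : @env_nil G = e)//; apply/funext => -[].
rewrite IH; split=> [[e [x pe]]|[e pe]]; first by exists (env_cons x e).
exists (fun i => e (lift ord0 i)), (e ord0).
rewrite (_ : env_cons _ _ = e)//; apply/funext => i; rewrite /env_cons.
by case: unliftP => [j ->|->].
Qed.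

Definition FTrue n : formula n := FAll (FEq ord0 ord0).

Lemma sat_conj (G : sgraph) n (I : eqType) (s : seq I) (p : I -> formula n)
    (e : 'I_n -> G) :
  sat (foldr (fun i => FAnd (p i)) (FTrue n) s) e <->
  forall i, i \in s -> sat (p i) e.
Proof.
elim: s => [|i s IH]; first by split.
rewrite /= IH; split=> [[pi ps] j|H].
  by rewrite inE => /predU1P[->|/ps].
by split=> [|j js]; apply: H; rewrite inE ?eqxx ?js ?orbT.
Qed.

Definition literal n (b : bool) (p : formula n) := if b then p else FNot p.

Definition diagram (F : sgraph) : formula #|F| :=
  foldr (fun ij : F * F =>
    FAnd (FAnd (literal (ij.1 == ij.2)
                  (FEq (enum_rank ij.1) (enum_rank ij.2)))
               (literal (adj ij.1 ij.2)
                  (FAdj (enum_rank ij.1) (enum_rank ij.2)))))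
    (FTrue #|F|) (enum {: F * F}).

Lemma expresses_diagram (F : sgraph) :
  expresses (ex_closure (diagram F)) (contains_induced F).
Proof.
move=> G; rewrite models_ex_closure contains_inducedP.
split=> [[e /sat_conj H]|[f [finj fadj]]].
  exists (fun x => e (enum_rank x)).
  have {}H x y := H (x, y) (mem_enum _ _).
  split=> x y; have /= [] := H x y.
    by rewrite /literal; case: eqP.
  by move=> _; rewrite /literal; case: (adj x y) => //= /negP/negbTE.
exists (fun i => f (enum_val i)); apply/sat_conj => -[x y] _ /=; split.
  rewrite /literal; case: eqP => [->//|ne] /=.
  by rewrite !enum_rankK => /finj.
rewrite /literal; case: ifP => /=; rewrite !enum_rankK fadj; first by [].
by move=> ->.
Qed.

Definition expressible_at_depth (F : sgraph) (d : nat) : Prop :=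
  exists p : sentence, expresses p (contains_induced F) /\ qdepth p = d.

Lemma ex_depth (F : sgraph) : exists d, `[< expressible_at_depth F d >].
Proof.
exists (qdepth (ex_closure (diagram F))); apply/asboolP.
by exists (ex_closure (diagram F)); split=> //; apply: expresses_diagram.
Qed.

(* D[F] *)
Definition min_depth (F : sgraph) : nat := ex_minn (ex_depth F).

(* Main.v *)
(** Existentially quantify a copy of [H] and relativize a sentence for
    [P_3 + K_1] to the vertices outside this copy that have no neighbour in it:
    this costs [v(H)] extra quantifiers, so it suffices to express [C[P_3 + K_1]]
    with quantifier depth 3.  The complement of [P_3 + K_1] is the paw, and in a
    paw-free graph the component of a vertex of a triangle is complete
    multipartite.  Hence a graph contains a paw iff it has a vertex [x] in a
    triangle and a vertex [y] at distance 2 from [x] missing some neighbour of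
    [x]; the sentence says this about the complement. *)
Require Import Defs.
From mathcomp Require Import all_boot.
From mathcomp Require Import boolp.

Set Implicit Arguments.
Unset Strict Implicit.
Unset Printing Implicit Defensive.

(** This is adjacency in the complement of [G], so statements about paws in the complement are
    written with [apart]. *)
Definition apart (G : sgraph) (x y : G) : bool := ~~ ((x == y) || adj x y).

Lemma apart_sym (G : sgraph) : symmetric (@apart G).
Proof. by move=> x y; rewrite /apart eq_sym adj_sym. Qed.

Lemma apartE (G : sgraph) (x y : G) : ~ (x = y \/ adj x y) <-> apart x y.
Proof.
rewrite /apart; split=> [H|/negP H].
  by apply/negP => /orP[/eqP|] h; apply: H; [left|right].
by case=> h; apply: H; rewrite h ?eqxx ?orbT.
Qed.

Definition FApart n (i j : 'I_n) : formula n := FNot (FOr (FEq i j) (FAdj i j)).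

Lemma sat_apart (G : sgraph) n (i j : 'I_n) (e : 'I_n -> G) :
  sat (FApart i j) e <-> apart (e i) (e j).
Proof. exact: apartE. Qed.

Lemma sat_and (G : sgraph) n (p q : formula n) (e : 'I_n -> G) :
  sat (FAnd p q) e = (sat p e /\ sat q e).
Proof. by []. Qed.

(** * Quantifier depth and the diagram formula *)

Lemma qdepth_sentence_gt0 (p : sentence) : 0 < qdepth p.
Proof.
(* The index is freed for the induction. An atom with [n = 0] would need a variable in ['I_0], so a
   sentence must contain a quantifier. *)
suff H n (q : formula n) : n = 0 -> 0 < qdepth q by exact: H.
elim: q => {n} [n [m mn] _|n [m mn] _|n q IH|n q IH r _|n q IH r _|//|//] /= n0.
- by rewrite n0 in mn.
- by rewrite n0 in mn.
- exact: IH.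
- by rewrite leq_max IH.
- by rewrite leq_max IH.
Qed.

Lemma qdepth_ex_closure n (p : formula n) :
  qdepth (ex_closure p) = n + qdepth p.
Proof. by elim: n p => //= n IH p; rewrite IH addnS. Qed.

(** The only quantifier is the one in the base [FTrue] of the fold; the literals have depth 0. *)
Lemma qdepth_diagram (F : sgraph) : qdepth (diagram F) = 1.
Proof.
rewrite /diagram; elim: (enum _) => //= -[x y] s /= ->.
by rewrite /literal; case: (x == y); case: (adj x y).
Qed.

Lemma sat_diagram (F G : sgraph) (e : 'I_#|F| -> G) :
  sat (diagram F) e <->
  injective e /\ forall x y, adj (e (enum_rank x)) (e (enum_rank y)) = adj x y.
Proof.
split=> [/sat_conj H|[einj eadj]].
  have {}H x y := H (x, y) (mem_enum _ _).
  split=> [i j|x y].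
    have /= [+ _] := H (enum_val i) (enum_val j).
    rewrite /literal; case: eqP => [/enum_val_inj//|_] /=.
    by rewrite !enum_valK.
  have /= [_] := H x y.
  by rewrite /literal; case: (adj x y) => //= /negP/negbTE.
apply/sat_conj => -[x y] _ /=; split.
  by rewrite /literal; case: eqP => [->//|ne] /= /einj/enum_rank_inj.
by rewrite /literal; case: ifP => /=; rewrite eadj => // ->.
Qed.

Lemma min_depth_le (F : sgraph) (p : sentence) :
  expresses p (contains_induced F) -> min_depth F <= qdepth p.
Proof.
move=> pF; rewrite /min_depth; case: ex_minnP => m _; apply.
by apply/asboolP; exists p.
Qed.

Lemma min_depthP (F : sgraph) : expressible_at_depth F (min_depth F).
Proof. by rewrite /min_depth; case: ex_minnP => m /asboolP. Qed.

(** * Relativization *)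

(** The parameters [c] come last: [n.+1 + h] is convertible to [(n + h).+1], so under a binder
    [ord0] is still the newly bound variable and the parameters stay in place. *)
Definition env_cat (T : Type) n h (e : 'I_n -> T) (c : 'I_h -> T) :
    'I_(n + h) -> T :=
  fun k => match split k with inl i => e i | inr j => c j end.

Lemma env_cat_lshift (T : Type) n h (e : 'I_n -> T) (c : 'I_h -> T) i :
  env_cat e c (lshift h i) = e i.
Proof. by rewrite /env_cat (unsplitK (inl i)). Qed.

Lemma env_cat_rshift (T : Type) n h (e : 'I_n -> T) (c : 'I_h -> T) j :
  env_cat e c (rshift n j) = c j.
Proof. by rewrite /env_cat (unsplitK (inr j)). Qed.

Lemma env_cat_nil (T : Type) h (e : 'I_0 -> T) (c : 'I_h -> T) :
  env_cat e c = c.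
Proof.
apply/funext => k; rewrite -[RHS](env_cat_rshift e c).
by congr env_cat; apply: val_inj.
Qed.

Lemma env_cons0 (T : Type) n (x : T) (e : 'I_n -> T) : env_cons x e ord0 = x.
Proof. by rewrite /env_cons unlift_none. Qed.

Lemma env_consS (T : Type) n (x : T) (e : 'I_n -> T) i :
  env_cons x e (lift ord0 i) = e i.
Proof. by rewrite /env_cons liftK. Qed.

Lemma env_cat_cons (T : Type) n h (x : T) (e : 'I_n -> T) (c : 'I_h -> T) :
  env_cat (env_cons x e) c = env_cons x (env_cat e c).
Proof.
apply/funext => k; case: (@unliftP (n + h).+1 ord0 k) => [k' ->|->].
  rewrite env_consS -(splitK k'); case: (split k') => [i|j] /=.
    rewrite (_ : lift _ _ = lshift h (lift ord0 i)); last exact: val_inj.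
    by rewrite !env_cat_lshift env_consS.
  rewrite (_ : lift _ _ = rshift n.+1 j); last exact: val_inj.
  by rewrite !env_cat_rshift.
rewrite env_cons0 (_ : ord0 = lshift h (ord0 : 'I_n.+1)); last exact: val_inj.
by rewrite env_cat_lshift env_cons0.
Qed.

Definition apart_set (G : sgraph) h (c : 'I_h -> G) : {set G} :=
  [set x | [forall j, apart x (c j)]].

(* The base of the fold is quantifier-free, unlike [FTrue], so that guarding  *)
(* a quantifier does not increase the depth.                                  *)
Definition guard n h : formula (n.+1 + h) :=
  foldr (fun j => FAnd (FApart (lshift h ord0) (rshift n.+1 j)))
    (FEq (lshift h ord0) (lshift h ord0)) (enum 'I_h).

Lemma qdepth_guard n h : qdepth (guard n h) = 0.
Proof. by rewrite /guard; elim: (enum _) => //= j s ->. Qed.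

Lemma sat_guard (G : sgraph) n h (x : G) (e : 'I_n -> G) (c : 'I_h -> G) :
  sat (guard n h) (env_cat (env_cons x e) c) <-> x \in apart_set c.
Proof.
rewrite inE.
have -> : [forall j, apart x (c j)] = all (fun j => apart x (c j)) (enum 'I_h).
  apply/forallP/allP => [H j _|H j]; first exact: H.
  by apply: H; rewrite mem_enum.
rewrite /guard; elim: (enum 'I_h) => [|j s IH]; first by split.
rewrite [foldr _ _ _]/= sat_and IH sat_apart.
rewrite env_cat_lshift env_cat_rshift env_cons0 /=.
by split=> [[-> ->]|/andP].
Qed.

Fixpoint relativize h n (p : formula n) : formula (n + h) :=
  match p in formula n return formula (n + h) with
  | FAdj _ i j => FAdj (lshift h i) (lshift h j)
  | FEq _ i j => FEq (lshift h i) (lshift h j)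
  | FNot _ p => FNot (relativize h p)
  | FAnd _ p q => FAnd (relativize h p) (relativize h q)
  | FOr _ p q => FOr (relativize h p) (relativize h q)
  | FEx n p => FEx (FAnd (guard n h) (relativize h p) : formula (n + h).+1)
  | FAll n p =>
      FAll (FOr (FNot (guard n h)) (relativize h p) : formula (n + h).+1)
  end.

Lemma qdepth_relativize h n (p : formula n) :
  qdepth (relativize h p) = qdepth p.
Proof.
by elim: p => //= {}n => [p -> q ->|p -> q ->|p IH|p IH] //;
  rewrite qdepth_guard max0n IH.
Qed.

Lemma sat_relativize (G : sgraph) h (c : 'I_h -> G) n (p : formula n)
    (e : 'I_n -> induced (apart_set c)) :
  sat (relativize h p) (env_cat (fun i => val (e i)) c) <-> sat p e.
Proof.
(* For the quantifier cases: extending the environment commutes with the inclusion of the induced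
   subgraph into [G]. *)
have val_cons m (x : induced (apart_set c)) (f : 'I_m -> _) :
    env_cons (val x) (env_cat (fun i => val (f i)) c) =
    env_cat (fun i => val (env_cons x f i)) c.
  rewrite -env_cat_cons (_ : env_cons _ _ = fun i => val (env_cons x f i)) //.
  by apply/funext => i; rewrite /env_cons; case: unlift.
elim: p e => {}n /=.
- by move=> i j e; rewrite !env_cat_lshift.
- by move=> i j e; rewrite !env_cat_lshift; split=> [/val_inj|->].
- by move=> p IH e; rewrite IH.
- by move=> p IHp q IHq e; rewrite IHp IHq.
- by move=> p IHp q IHq e; rewrite IHp IHq.
- move=> p IH e; split=> [[x []]|[x px]].
    rewrite -env_cat_cons => /sat_guard xS px; exists (exist _ x xS).
    by apply/IH; rewrite -val_cons -env_cat_cons.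
  exists (val x); split; last by rewrite val_cons; apply/IH.
  by rewrite -env_cat_cons; apply/sat_guard/(valP x).
- move=> p IH e; split=> [H x|H x].
    case: (H (val x)) => [[]|]; last by rewrite val_cons => /IH.
    by rewrite -env_cat_cons; apply/sat_guard/(valP x).
  have [xS|xS] := boolP (x \in apart_set c); [right|left].
    rewrite -[x]/(val (exist (fun x => x \in apart_set c) x xS : induced _)).
    by rewrite val_cons; apply/IH.
  by rewrite -env_cat_cons => /sat_guard; apply/negP.
Qed.

(** * Disjoint unions *)

Lemma contains_induced_dunion (F H G : sgraph) :
  contains_induced (dunion F H) G <->
  exists c : 'I_#|H| -> G, sat (diagram H) c /\
    contains_induced F (induced (apart_set c)).
Proof.
rewrite contains_inducedP; split=> [[f [finj fadj]]|].
  pose c (j : 'I_#|H|) := f (inr (enum_val j)); exists c; split.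
    apply/sat_diagram; split=> [i j /finj[/enum_val_inj]//|x y].
    by rewrite /c !enum_rankK fadj.
  apply/contains_inducedP.
  have fS x : f (inl x) \in apart_set c.
    by rewrite inE; apply/forallP => j; rewrite /apart fadj (inj_eq finj).
  exists (fun x => exist (fun u => u \in apart_set c) _ (fS x)).
  split=> [x y [/finj[]]//|x y].
  by rewrite /= /induced_rel fadj.
case=> c [/sat_diagram[cinj cadj]] /contains_inducedP[g [ginj gadj]].
pose f (u : F + H) := match u with
  | inl x => val (g x) | inr y => c (enum_rank y) end.
(* Since [apart] excludes equality as well as adjacency, this gives both injectivity of [f] across
   the two summands and the absence of edges between them. *)
have gc x y : apart (val (g x)) (c y).
  by have := valP (g x); rewrite inE => /forallP.
exists f; split=> [[x|x] [y|y]|[x|x] [y|y]] /=.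
- by move=> /val_inj/ginj->.
- by move=> E; have := gc x (enum_rank y); rewrite /apart -E eqxx.
- by move=> E; have := gc y (enum_rank x); rewrite /apart E eqxx.
- by move=> /cinj/enum_rank_inj->.
- exact: gadj.
- by apply/negbTE; have := gc x (enum_rank y); rewrite /apart negb_or => /andP[].
- apply/negbTE; have := gc y (enum_rank x).
  by rewrite apart_sym /apart negb_or => /andP[].
- exact: cadj.
Qed.

Lemma min_depth_dunion (F H : sgraph) :
  min_depth (dunion F H) <= min_depth F + num_vertices H.
Proof.
have [p [pF <-]] := min_depthP F.
pose q : formula #|H| := FAnd (diagram H) (relativize #|H| p).
have qE : qdepth (ex_closure q) = qdepth p + num_vertices H.
  rewrite qdepth_ex_closure addnC; congr (_ + _).
  transitivity (maxn (qdepth (diagram H)) (qdepth (relativize #|H| p))) => //.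
  (* The depth 1 of the diagram is absorbed by the maximum, because the sentence [p] has depth at
     least 1. *)
  rewrite qdepth_diagram qdepth_relativize.
  exact/maxn_idPr/qdepth_sentence_gt0.
rewrite -qE; apply: min_depth_le => G.
rewrite models_ex_closure contains_induced_dunion.
(* As [0 + #|H|] reduces to [#|H|], the free variables of the relativized sentence are exactly the
   parameters [c]. *)
have cE (c : 'I_#|H| -> G) :
    sat (relativize #|H| p : formula #|H|) c <->
    contains_induced F (induced (apart_set c)).
  by rewrite -pF /models -(@sat_relativize G _ c) env_cat_nil.
split=> -[c].
  by rewrite sat_and => -[Hc /cE]; exists c.
by case=> Hc /cE; exists c.
Qed.

(** * The graph [P_3 + K_1] *)

Local Notation copaw := (dunion (path_graph 3) (complete_graph 1)).

Lemma contains_copawP (G : sgraph) :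
  contains_induced copaw G <->
  exists a b c d : G, [/\ adj a b, adj b c & apart a c] /\
    [/\ apart d a, apart d b & apart d c].
Proof.
rewrite contains_inducedP; split=> [[f [finj fadj]]|].
  pose v k (k3 : k < 3) := f (inl (Ordinal k3)).
  exists (v 0 isT), (v 1 isT), (v 2 isT), (f (inr ord0)).
  by rewrite /apart /v !fadj !(inj_eq finj).
case=> a [b [c [d [[ab bc ac] [da db dc]]]]].
pose f (u : copaw) :=
  match u with inl i => nth a [:: a; b; c] i | inr _ => d end.
(* Both [adj] and [apart] force distinct vertices, so each of the 16 pairs has its equality and
   adjacency decided at once. *)
have E : forall u v, (f u == f v) = (u == v) /\ adj (f u) (f v) = adj u v.
  have sym (x y : G) s t :
      (x == y) = s /\ adj x y = t -> (y == x) = s /\ adj y x = t.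
    by rewrite eq_sym adj_sym.
  have A (x y : G) : apart x y -> (x == y) = false /\ adj x y = false.
    by rewrite /apart negb_or => /andP[/negbTE-> /negbTE->].
  have B (x y : G) : adj x y -> (x == y) = false /\ adj x y = true.
    by move=> xy; split=> //; apply/eqP => E; rewrite E adj_irr in xy.
  have C (x : G) : (x == x) = true /\ adj x x = false.
    by rewrite eqxx adj_irr.
  case=> [[[|[|[|//]]] ?]|[[|//] ?]] [[[|[|[|//]]] ?]|[[|//] ?]];
  by [exact: C | exact: A | exact: B | apply/sym; exact: A | apply/sym; exact: B].
exists f; split=> u v; last by case: (E u v).
by move/eqP; rewrite (E u v).1 => /eqP.
Qed.

(** Read in the complement, the first conjunct puts [x] in a triangle; in the second, [y] is a
    non-neighbour of [x] sharing a neighbour with it and missing another neighbour of [x].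
    Conversely, either a paw appears at once, or the common neighbour [z] lies in a triangle with
    [x] and some [w], and [y] and the missed neighbour [t] are compared with [z] and [w]. *)
Lemma contains_copaw_depth3 (G : sgraph) :
  contains_induced copaw G <->
  exists x : G,
    (exists y, apart y x /\ exists z, apart z x /\ apart z y) /\
    (exists y, adj y x /\ ((exists z, apart z x /\ apart z y) /\
                           (exists z, apart z x /\ adj z y))).
Proof.
rewrite contains_copawP; split.
  case=> a [b [c [d [[ab bc ac] [da db dc]]]]]; exists a; split.
    by exists c; rewrite apart_sym; split=> //; exists d.
  exists b; rewrite adj_sym; split=> //; split; first by exists d.
  by exists c; rewrite apart_sym adj_sym.
case=> x [[p [px [q [qx qp]]]] [y [yx [[z [zx zy]] [t [tx ty]]]]]].
have adjN (u v : G) : ~~ apart u v -> u != v -> adj u v.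
  by rewrite /apart negbK => /orP[/eqP->|//]; rewrite eqxx.
(* [z] can be completed with [x] to an independent triple. *)
have [[w [wx wz]]|Nw] := pselect (exists w, apart w x /\ apart w z); last first.
  have zN u : apart u x -> ~~ apart u z.
    by move=> ux; apply/negP => ?; apply: Nw; exists u.
  (* Otherwise, in the complement, [z] is a pendant vertex at [x] of the triangle [x], [p], [q]. *)
  have pz : adj p z.
    by apply: adjN (zN _ px) _; apply/eqP => E; case/negP: (zN _ qx); rewrite -E.
  have qz : adj q z.
    apply: adjN (zN _ qx) _; apply/eqP => E; case/negP: (zN _ px).
    by rewrite -E apart_sym.
  exists p, z, q, x; rewrite [adj z q]adj_sym [apart p q]apart_sym.
  by rewrite ![apart x _]apart_sym.
have yNE u : apart u x -> y != u.
  by apply: contraL => /eqP<-; rewrite /apart negbK yx orbT.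
(* If [y] misses [w] in the complement, it is pendant at [z] on the triangle [x], [z], [w].
   Otherwise [y] is joined there to both [z] and [w]. *)
have [wy|/adjN yw] := boolP (apart w y); last first.
  exists x, y, w, z; rewrite [adj x y]adj_sym [apart x w]apart_sym.
  by rewrite [adj y w]adj_sym [apart z w]apart_sym yw // eq_sym yNE.
(* In the complement: triangle [x], [t], [u] with [y] pendant at [u]; it is applied to [u = z] and
   [u = w]. *)
have via u : apart u x -> apart u y -> apart u t ->
    exists a b c d : G, [/\ adj a b, adj b c & apart a c] /\
      [/\ apart d a, apart d b & apart d c].
  move=> ux uy ut; exists x, y, t, u.
  by rewrite [adj x y]adj_sym [adj y t]adj_sym [apart x t]apart_sym.
have [?|/adjN zt] := boolP (apart z t); first exact: (via z).
have [?|/adjN wt] := boolP (apart w t); first exact: (via w).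
have neq u : apart u y -> u != t.
  by apply: contraL => /eqP->; rewrite /apart negbK ty orbT.
(* Now [t] misses [z] and [w] in the complement, so it is pendant at [x] on the triangle [x], [z],
   [w]. *)
exists z, t, w, x; rewrite zt ?neq // [adj t w]adj_sym wt ?neq //.
by rewrite [apart z w]apart_sym ![apart x _]apart_sym.
Qed.

(** [v0], [v1], [v2] are de Bruijn indices counted from the innermost binder; their argument only
    pads the type, so that the total number of variables in scope matches. *)
Definition copaw_sentence : sentence :=
  let v0 n : 'I_n.+1 := ord0 in
  let v1 n : 'I_n.+2 := lift ord0 ord0 in
  let v2 n : 'I_n.+3 := lift ord0 (lift ord0 ord0) in
  FEx (FAnd
    (FEx (FAnd (FApart (v0 1) (v1 0))
       (FEx (FAnd (FApart (v0 2) (v2 0)) (FApart (v0 2) (v1 1))))))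
    (FEx (FAnd (FAdj (v0 1) (v1 0))
       (FAnd
          (FEx (FAnd (FApart (v0 2) (v2 0)) (FApart (v0 2) (v1 1))))
          (FEx (FAnd (FApart (v0 2) (v2 0)) (FAdj (v0 2) (v1 1)))))))).

Lemma expresses_copaw_sentence :
  expresses copaw_sentence (contains_induced copaw).
Proof.
have ex_iff T (P Q : T -> Prop) :
    (forall x, P x <-> Q x) -> (exists x, P x) <-> (exists x, Q x).
  by move=> PQ; split=> -[x /PQ]; exists x.
have and_iff A A' B B' : (A <-> A') -> (B <-> B') -> (A /\ B) <-> (A' /\ B').
  by move=> -> ->.
have envE := (env_consS, env_cons0).
move=> G; rewrite contains_copaw_depth3 /models /copaw_sentence.
by apply: (ex_iff) => x; apply: (and_iff); apply: (ex_iff) => y; apply: (and_iff);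
  try (apply: (and_iff)); try (apply: (ex_iff) => z; apply: (and_iff));
  rewrite /= !envE ?apartE.
Qed.

Theorem theorem1 (H : sgraph) :
  let F := dunion (dunion (path_graph 3) (complete_graph 1)) H in
  min_depth F <= num_vertices F - 1.
Proof.
rewrite /=; apply: leq_trans (min_depth_dunion _ _) _.
(* The four vertices of [P_3 + K_1] exceed the depth 3 of [copaw_sentence] by one, which is the
   vertex saved. *)
have -> : num_vertices (dunion copaw H) - 1 = 3 + num_vertices H.
  by rewrite /num_vertices !card_sum !card_ord.
by rewrite leq_add2r; apply: min_depth_le expresses_copaw_sentence.
Qed.
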